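(* Let $(\mathcal{E},\mathcal{E}')$ be a nested pair of ellipses in the plane ($\mathcal{E}'$ inside $\mathcal{E}$, not necessarily concentric or axis-aligned) admitting a family of Poncelet triangles. Suppose that a triangle center $X_k$ is stationary over this family, i.e. it is the same point for every triangle of the family. Let $\mathcal{X}=\alpha X_2+\beta X_3+\gamma X_k$ be a fixed linear combination of $X_2$, $X_3$ and $X_k$, i.e. $\alpha,\beta,\gamma\in\mathbb{C}$ are constants not depending on the triangle in the family. Then the locus of $\mathcal{X}$ over the family is an ellipse (possibly degenerate).
   Context: The plane is identified with $\mathbb{C}$, with a fixed origin, so that points can be linearly combined with complex coefficients. A Poncelet triangle of the pair $(\mathcal{E},\mathcal{E}')$ is a triangle with its three vertices on $\mathcal{E}$ and its three side lines tangent to $\mathcal{E}'$. By Poncelet's closure theorem, if one such triangle exists then every point of $\mathcal{E}$ is a vertex of exactly one such triangle; the resulting one-parameter family is the family of Poncelet triangles. A triangle center is a point assigned to each triangle, independently of the labelling of the vertices and compatibly with similarities of the plane. $X_2$ denotes the barycenter (centroid) and $X_3$ the circumcenter of a triangle. The locus of a point depending on the triangle is the set of positions of that point over all triangles of the family. Circles count as ellipses, and an elliptic locus is allowed to be degenerate, meaning that one or both of its semi-axes are zero, so that it is a segment or a single point. *)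

(* Defs.v *)
From HB Require Import structures.
From mathcomp Require Import all_boot all_order all_algebra.
From mathcomp Require Import classical_sets reals complex.

Set Implicit Arguments.
Unset Strict Implicit.
Unset Printing Implicit Defensive.

Import Order.TTheory GRing.Theory Num.Theory.
Local Open Scope ring_scope.
Local Open Scope complex_scope.
Local Open Scope classical_set_scope.

(* Possibly degenerate ellipses of the plane R[i]. The two axes point in the
   directions [axis] and ['i * axis]; no order is imposed on the semi-axes. *)
Record ellipse (R : realType) := Ellipse {
  center : R[i];
  axis : R[i];
  semiaxis1 : R;
  semiaxis2 : R;
  axis_unit : `|axis| = 1;
  semiaxis1_ge0 : 0 <= semiaxis1;
  semiaxis2_ge0 : 0 <= semiaxis2
}.

Definition nondegenerate_ellipse (R : realType) (E : ellipse R) : Prop :=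
  0 < semiaxis1 E /\ 0 < semiaxis2 E.

Definition curve (R : realType) (E : ellipse R) : set R[i] :=
  [set z | exists x y : R, x ^+ 2 + y ^+ 2 = 1 /\
     z = center E + axis E * ((semiaxis1 E * x) +i* (semiaxis2 E * y))].

(* The open region bounded by the curve (when E is nondegenerate). *)
Definition inner_region (R : realType) (E : ellipse R) : set R[i] :=
  [set z | exists x y : R, x ^+ 2 + y ^+ 2 < 1 /\
     z = center E + axis E * ((semiaxis1 E * x) +i* (semiaxis2 E * y))].

Definition nested (R : realType) (E E' : ellipse R) : Prop :=
  curve E' `<=` inner_region E.

Definition line (R : realType) (A B : R[i]) : set R[i] :=
  [set z | exists t : R, z = A + t%:C * (B - A)].

(* For a line and a nondegenerate ellipse, tangency means having exactly one
   common point. *)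
Definition tangent (R : realType) (l : set R[i]) (E : ellipse R) : Prop :=
  exists! p, l p /\ curve E p.

Definition triangle (R : realType) (A B C : R[i]) : Prop :=
  A <> B /\ ~ line A B C.

Definition poncelet (R : realType) (E E' : ellipse R) (A B C : R[i]) : Prop :=
  [/\ triangle A B C,
      [/\ curve E A, curve E B & curve E C] &
      [/\ tangent (line A B) E', tangent (line B C) E'
        & tangent (line C A) E']].

Definition barycenter (R : realType) (A B C : R[i]) : R[i] :=
  (A + B + C) / 3%:R.

Definition is_circumcenter (R : realType) (A B C O : R[i]) : Prop :=
  `|O - A| = `|O - B| /\ `|O - B| = `|O - C|.

(* Both orientation-preserving and orientation-reversing similarities. *)
Definition similarity (R : realType) (s : R[i] -> R[i]) : Prop :=
  exists2 k : R, 0 < k & forall z w, `|s z - s w| = k%:C * `|z - w|.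

(* The values of X at collinear triples are irrelevant. The swap and the
   rotation below generate all relabellings of the vertices. *)
Definition triangle_center (R : realType)
    (X : R[i] -> R[i] -> R[i] -> R[i]) : Prop :=
  forall A B C, triangle A B C ->
    [/\ X B A C = X A B C,
        X B C A = X A B C
      & forall s, similarity s -> X (s A) (s B) (s C) = s (X A B C)].

Definition stationary (R : realType) (E E' : ellipse R)
    (X : R[i] -> R[i] -> R[i] -> R[i]) : Prop :=
  exists P, forall A B C, poncelet E E' A B C -> X A B C = P.

Definition locus (R : realType) (E E' : ellipse R)
    (alpha beta gamma : R[i]) (Xk : R[i] -> R[i] -> R[i] -> R[i]) :
    set R[i] :=
  [set Z | exists A B C O, [/\ poncelet E E' A B C, is_circumcenter A B C O
     & Z = alpha * barycenter A B C + beta * O + gamma * Xk A B C]].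

(* Main.v *)
Require Import Defs.
From mathcomp Require Import all_boot all_order all_algebra ring.
From mathcomp Require Import classical_sets reals complex.

(* Parametrise E by the affine map z |-> c + p z + q z^* on the unit circle and
   pull E' back to an ellipse with foci f, g in the open unit disk; put
   F = f + g and H = f g.  Tangency of the chord z1 z2 of the unit circle is a
   quadratic relation between z1 + z2 and z1 z2.  Hence the inscribed triangle
   z1 z2 z3 is a Poncelet triangle iff its elementary symmetric functions are
     s1 = F + l H^*,  s2 = H + l F^*,  s3 = l   with |l| = 1
   together with a closure condition on E' alone, and these are the fibers of
   the Blaschke product z (z - f) (z - g) / ((1 - f^* z) (1 - g^* z)), so every
   unimodular l occurs.  The barycenter and the circumcenter of the triangle in
   the original plane are real-affine in s1 and l, so every
   alpha X2 + beta X3 + constant has the form w + u l + v l^*, which traces an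
   ellipse. *)

Set Implicit Arguments.
Unset Strict Implicit.
Unset Printing Implicit Defensive.

Import Order.TTheory GRing.Theory Num.Theory.
Local Open Scope complex_scope.
Local Open Scope ring_scope.

(** * Ring identities and the algebra of the tangency relation *)

Lemma eq_scale (K : pzRingType) (k l r : K) : l = r -> k * l = k * r.
Proof. by move->. Qed.

Lemma eq_sum (K : pzRingType) (l r l' r' : K) :
  l = r -> l' = r' -> l + l' = r + r'.
Proof. by move=> -> ->. Qed.

(** Serves to prove an equation from a linear combination of hypotheses: [l' = r'] is the
    combination, built with [eq_sum] and [eq_scale], and the remaining goal is an identity for
    [ring] or [field]. *)
Lemma eq_of_diff (K : pzRingType) (l r l' r' : K) :
  l' = r' -> l - r = l' - r' -> l = r.
Proof. by move=> ->; rewrite subrr => /subr0_eq. Qed.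

(* The tangency condition of the chord of the unit circle whose endpoints have
   sum [s] and product [pi]; [Fb] and [Hb] stand for the conjugates. *)
Definition chord_conic (K : comPzRingType) (F Fb H Hb B s pi : K) : K :=
  s ^+ 2 - s * (F + pi * Fb) + (H + B * pi + Hb * pi ^+ 2).

Lemma quadratic_vieta (K : fieldType) (a b c x y : K) : x != y ->
  a * x ^+ 2 + b * x + c = 0 -> a * y ^+ 2 + b * y + c = 0 ->
  a * (x + y) = - b /\ a * (x * y) = c.
Proof.
move=> nxy hx hy; have nz : x - y != 0 by rewrite subr_eq0.
have hs : a * (x + y) = - b.
  apply: (mulfI nz); apply: (eq_of_diff (eq_sum hx (eq_scale (-1) hy))); ring.
by split=> //; apply: (eq_of_diff (eq_sum (eq_scale x hs) (eq_scale (-1) hx)));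
  ring.
Qed.

(** With one endpoint [t] fixed, tangency of the chord is a quadratic equation for the other
    endpoint. Its two roots are the remaining vertices, and Vieta's formulas apply. *)
Lemma chord_conic_vertex (K : fieldType) (F Fb H Hb B t x y : K) : x != y ->
  chord_conic F Fb H Hb B (t + x) (t * x) = 0 ->
  chord_conic F Fb H Hb B (t + y) (t * y) = 0 ->
  (x + y) * (1 - t * Fb + Hb * t ^+ 2) = - ((2 + B) * t - F - t ^+ 2 * Fb) /\
  x * y * (1 - t * Fb + Hb * t ^+ 2) = t ^+ 2 - t * F + H.
Proof.
rewrite /chord_conic => nxy hx hy.
have [||hs hp] := @quadratic_vieta _ (1 - t * Fb + Hb * t ^+ 2)
  ((2 + B) * t - F - t ^+ 2 * Fb) (t ^+ 2 - t * F + H) _ _ nxy.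
- by apply: (eq_of_diff hx); ring.
- by apply: (eq_of_diff hy); ring.
by split; rewrite mulrC.
Qed.

(* By [chord_conic_vertex] the three vertices are the roots of the cubic
   t^3 - (F + lam Hb) t^2 + (H + lam Fb) t - lam with lam = x y z. *)
Lemma chord_conic_triangle (K : fieldType) (F Fb H Hb B x y z : K) :
  x != 0 -> x != y -> y != z -> z != x ->
  chord_conic F Fb H Hb B (x + y) (x * y) = 0 ->
  chord_conic F Fb H Hb B (y + z) (y * z) = 0 ->
  chord_conic F Fb H Hb B (z + x) (z * x) = 0 ->
  [/\ x + y + z = F + x * y * z * Hb,
      x * y + y * z + z * x = H + x * y * z * Fb
    & B = F * Fb - H * Hb - 1].
Proof.
move=> x0 nxy nyz nzx hxy hyz hzx.
have hyx : chord_conic F Fb H Hb B (y + x) (y * x) = 0.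
  by rewrite addrC mulrC.
have hzy : chord_conic F Fb H Hb B (z + y) (z * y) = 0.
  by rewrite addrC [z * y]mulrC.
have hxz : chord_conic F Fb H Hb B (x + z) (x * z) = 0.
  by rewrite addrC [x * z]mulrC.
have [sx px] := chord_conic_vertex nyz hxy hxz.
have [_ py] := chord_conic_vertex nzx hyz hyx.
have [_ pz] := chord_conic_vertex nxy hzx hzy.
set lam := x * y * z.
have cub t w : w * (1 - t * Fb + Hb * t ^+ 2) = t ^+ 2 - t * F + H ->
    t * w = lam -> (H + lam * Fb - lam * Hb * t - F * t + t ^+ 2) * t = lam.
  move=> ht hl; apply: (eq_of_diff (eq_sum (eq_scale (- t) ht)
    (eq_scale (1 - t * Fb + Hb * t ^+ 2) hl))); ring.
have cx := cub _ _ px (mulrA x y z).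
have cy : (H + lam * Fb - lam * Hb * y - F * y + y ^+ 2) * y = lam.
  by apply: cub py _; rewrite /lam; ring.
have cz : (H + lam * Fb - lam * Hb * z - F * z + z ^+ 2) * z = lam.
  by apply: cub pz _; rewrite /lam; ring.
(* First divided difference of the cubic. A second one, taken between [qxy] and [qyz], leaves the
   sum of the roots. *)
have quot s t : s != t ->
    (H + lam * Fb - lam * Hb * s - F * s + s ^+ 2) * s = lam ->
    (H + lam * Fb - lam * Hb * t - F * t + t ^+ 2) * t = lam ->
    s ^+ 2 + s * t + t ^+ 2 - (F + lam * Hb) * (s + t) + (H + lam * Fb) = 0.
  move=> nst hs ht; have nz : s - t != 0 by rewrite subr_eq0.
  apply: (mulfI nz).
  by apply: (eq_of_diff (eq_sum hs (eq_scale (-1) ht))); ring.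
have qxy := quot _ _ nxy cx cy; have qyz := quot _ _ nyz cy cz.
have h1 : x + y + z = F + lam * Hb.
  have nz : x - z != 0 by rewrite subr_eq0 eq_sym.
  apply: (mulfI nz).
  by apply: (eq_of_diff (eq_sum qxy (eq_scale (-1) qyz))); ring.
have h2 : x * y + y * z + z * x = H + lam * Fb.
  by apply: (eq_of_diff (eq_sum (eq_scale (x + y) h1) (eq_scale (-1) qxy)));
    ring.
(* Eliminating [y + z] and [y * z] from the sum relation [sx] leaves [x] times the closure
   condition. *)
split=> //; apply: (mulfI x0).
apply: (eq_of_diff (eq_sum sx
  (eq_sum (eq_scale (- (1 - x * Fb + Hb * x ^+ 2)) h1)
    (eq_scale (- x * Hb) px)))).
rewrite /lam; ring.
Qed.

(** Converse of [chord_conic_triangle] for one side. Once [F] and [H] are solved for, it is a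
    polynomial identity. *)
Lemma chord_conicP (K : fieldType) (F Fb H Hb B x y z : K) :
  x + y + z = F + x * y * z * Hb ->
  x * y + y * z + z * x = H + x * y * z * Fb ->
  B = F * Fb - H * Hb - 1 ->
  chord_conic F Fb H Hb B (x + y) (x * y) = 0.
Proof.
move=> h1 h2 ->; have -> : F = x + y + z - x * y * z * Hb by rewrite h1 addrK.
have -> : H = x * y + y * z + z * x - x * y * z * Fb by rewrite h2 addrK.
rewrite /chord_conic; ring.
Qed.

(** * Unimodular numbers and fibers of Blaschke products *)

Lemma mul_conj_unit (C : numClosedFieldType) (z : C) : `|z| = 1 -> z * z^* = 1.
Proof. by rewrite -normCK => ->; rewrite expr1n. Qed.

Lemma unit_neq0 (C : numClosedFieldType) (z : C) : `|z| = 1 -> z != 0.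
Proof. by move=> h; rewrite -normr_eq0 h oner_eq0. Qed.

Lemma conj_unit (C : numClosedFieldType) (z : C) : `|z| = 1 -> z^* = z^-1.
Proof.
move=> h; apply: (mulfI (unit_neq0 h)).
by rewrite mul_conj_unit ?divff ?unit_neq0.
Qed.

(** Compares the Blaschke factor [(t - f) / (1 - f^* * t)] with the unit circle: for [f] in the open
    disk, the sign depends only on the side of the circle on which [t] lies. *)
Lemma moebius_diff (C : numClosedFieldType) (f t : C) :
  `|1 - f^* * t| ^+ 2 - `|t - f| ^+ 2 = (1 - `|t| ^+ 2) * (1 - `|f| ^+ 2).
Proof. by rewrite !normCK !(rmorphB, rmorphM) rmorph1 /= conjCK; ring. Qed.

Lemma moebius_lt (C : numClosedFieldType) (f t : C) :
  `|f| < 1 -> `|t| < 1 -> `|t - f| < `|1 - f^* * t|.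
Proof.
move=> hf ht; rewrite -(ltr_pXn2r (n := 2)) ?nnegrE //.
by rewrite -subr_gt0 moebius_diff mulr_gt0 // subr_gt0 exprn_ilt1.
Qed.

Lemma moebius_gt (C : numClosedFieldType) (f t : C) :
  `|f| < 1 -> 1 < `|t| -> `|1 - f^* * t| < `|t - f|.
Proof.
move=> hf ht; rewrite -(ltr_pXn2r (n := 2)) ?nnegrE //.
rewrite -subr_lt0 moebius_diff nmulr_rlt0; first by rewrite subr_gt0 exprn_ilt1.
by rewrite subr_lt0 exprn_egt1.
Qed.

(** All factors of the Blaschke product have modulus above 1 outside the closed disk and below 1
    inside the open disk, so a unimodular value is taken only on the circle. The equation is cleared
    of denominators. *)
Lemma blaschke_unit (C : numClosedFieldType) (f g lam t : C) :
  `|f| < 1 -> `|g| < 1 -> `|lam| = 1 ->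
  t * (t - f) * (t - g) = lam * ((1 - f^* * t) * (1 - g^* * t)) -> `|t| = 1.
Proof.
move=> hf hg hl /(congr1 Num.norm); rewrite !normrM hl mul1r.
move: (real_ltgtP (real1 C) (normr_real t)) => [ht|ht|//] e.
- have: `|1 - f^* * t| * `|1 - g^* * t| < `|t - f| * `|t - g|.
    by rewrite ltr_pM // moebius_gt.
  rewrite -e -mulrA => /lt_geF.
  by rewrite ler_peMl ?mulr_ge0 // ltW.
- have: `|t - f| * `|t - g| < `|1 - f^* * t| * `|1 - g^* * t|.
    by rewrite ltr_pM // moebius_lt.
  rewrite -e -mulrA => /lt_geF.
  by rewrite ler_piMl ?mulr_ge0 // ltW.
Qed.

Lemma sub_conj_unit (C : numClosedFieldType) (f t : C) : `|t| = 1 ->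
  (t - f) * (1 - f^* * t) = t * `|t - f| ^+ 2.
Proof.
move=> /mul_conj_unit h; rewrite normCK rmorphB /=.
by apply: (eq_of_diff (eq_scale (f - t) h)); ring.
Qed.

(* On the unit circle the logarithmic derivative of a Blaschke product,
   multiplied by t, is a sum of positive terms. *)
Lemma blaschke_simple (C : numClosedFieldType) (f g lam t : C) :
  `|f| < 1 -> `|g| < 1 -> `|t| = 1 ->
  t * (t - f) * (t - g) = lam * ((1 - f^* * t) * (1 - g^* * t)) ->
  3 * t ^+ 2 - 2 * (f + g + lam * (f * g)^*) * t
    + (f * g + lam * (f + g)^*) != 0.
Proof.
move=> hf hg ht e; apply/eqP => e'.
have := sub_conj_unit f ht; have := sub_conj_unit g ht.
set b := `|t - g| ^+ 2; set a := `|t - f| ^+ 2 => hb ha.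
have agt0 : 0 < a.
  rewrite exprn_gt0 // normr_gt0 subr_eq0; apply/eqP => tf.
  by move: hf; rewrite -tf ht ltxx.
have bgt0 : 0 < b.
  rewrite exprn_gt0 // normr_gt0 subr_eq0; apply/eqP => tg.
  by move: hg; rewrite -tg ht ltxx.
(* The bracket is [a * b] times the logarithmic derivative [1 + (1 - |f|^2) / a + (1 - |g|^2) / b];
   a double root would annul it. *)
have : t ^+ 2 * (a * b + b * (1 - `|f| ^+ 2) + a * (1 - `|g| ^+ 2)) = 0.
  rewrite !normCK.
  transitivity (t * a * (t * b) + t * (t * b) * (1 - f * f^*)
                + t * (t * a) * (1 - g * g^*)); first by ring.
  rewrite -ha -hb; move: e'; rewrite rmorphD rmorphM /= => e'.
  apply: (eq_of_diff (eq_sum (eq_scale ((1 - f^* * t) * (1 - g^* * t)) e')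
    (eq_scale (f^* * (1 - g^* * t) + g^* * (1 - f^* * t)) e))).
  ring.
apply/eqP; apply: mulf_neq0; first by rewrite expf_neq0 // unit_neq0.
apply: lt0r_neq0.
have lt1 (x : C) : `|x| < 1 -> 0 < 1 - `|x| ^+ 2 :> C.
  by move=> hx; rewrite subr_gt0 exprn_ilt1.
by apply: addr_gt0; [apply: addr_gt0|]; apply: mulr_gt0 => //; apply: lt1.
Qed.

Lemma cubic_roots (C : closedFieldType) (a b c : C) :
  exists x y z, [/\ x + y + z = a, x * y + y * z + z * x = b & x * y * z = c].
Proof.
have [x hx] := @solve_monicpoly C 3 (fun i => nth 0 [:: c; - b; a] i) isT.
have [y hy] := @solve_monicpoly C 2
  (fun i => nth 0 [:: - (x ^+ 2 - a * x + b); a - x] i) isT.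
move: hx hy; rewrite !big_ord_recl !big_ord0 /= => hx hy.
exists x, y, (a - x - y); split; first by ring.
  by apply: (eq_of_diff (eq_scale (-1) hy)); ring.
apply: (eq_of_diff (eq_sum hx (eq_scale (- x) hy))); ring.
Qed.

(** The fiber over [lam] is the root set of a cubic with the prescribed symmetric functions. The
    roots are unimodular by [blaschke_unit] and distinct by [blaschke_simple]. *)
Lemma blaschke_fiber (C : numClosedFieldType) (f g lam : C) :
  `|f| < 1 -> `|g| < 1 -> `|lam| = 1 ->
  exists x y z : C, [/\ [/\ `|x| = 1, `|y| = 1 & `|z| = 1],
    [/\ x != y, y != z & z != x] &
    [/\ x + y + z = f + g + lam * (f * g)^*,
        x * y + y * z + z * x = f * g + lam * (f + g)^*
      & x * y * z = lam]].
Proof.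
move=> hf hg hl.
have [x [y [z [h1 h2 h3]]]] :=
  cubic_roots (f + g + lam * (f * g)^*) (f * g + lam * (f + g)^*) lam.
have root t : (t - x) * (t - y) * (t - z) = 0 ->
    t * (t - f) * (t - g) = lam * ((1 - f^* * t) * (1 - g^* * t)).
  move: h1 h2; rewrite rmorphD rmorphM /= => h1 h2 ht.
  apply: (eq_of_diff (eq_sum ht (eq_sum (eq_scale (t ^+ 2) h1)
    (eq_sum (eq_scale (- t) h2) h3)))); ring.
have rx : (x - x) * (x - y) * (x - z) = 0 by ring.
have ry : (y - x) * (y - y) * (y - z) = 0 by ring.
have rz : (z - x) * (z - y) * (z - z) = 0 by ring.
have [ux uy uz] : [/\ `|x| = 1, `|y| = 1 & `|z| = 1].
  by split; apply: (blaschke_unit hf hg hl (root _ _)).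
(* This is the derivative of [(t - x) * (t - y) * (t - z)]; it would vanish at a repeated root. *)
have simple t : `|t| = 1 -> (t - x) * (t - y) * (t - z) = 0 ->
  (t - x) * (t - y) + (t - y) * (t - z) + (t - z) * (t - x) != 0.
  move=> ut rt; have := blaschke_simple hf hg ut (root _ rt).
  by rewrite -h1 -h2; congr (_ != _); ring.
exists x, y, z; split=> //; split; apply/eqP => e.
- by have /eqP[] := simple _ ux rx; rewrite e; ring.
- by have /eqP[] := simple _ uy ry; rewrite e; ring.
- by have /eqP[] := simple _ uz rz; rewrite e; ring.
Qed.

(** * Real-affine maps and chords of the unit circle *)

Definition aff (C : numClosedFieldType) (c p q z : C) : C :=
  c + p * z + q * z^*.

Lemma aff_chord (C : numClosedFieldType) (c p q x y t : C) :
  t \is Num.real ->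
  aff c p q (x + t * (y - x)) =
  aff c p q x + t * (aff c p q y - aff c p q x).
Proof.
move=> /CrealP ht; rewrite /aff rmorphD rmorphM rmorphB /= ht; ring.
Qed.

(** The quantity [p * p^* - q * q^*] is the Jacobian determinant of the map; combining the equation
    with its conjugate eliminates the conjugate variable. *)
Lemma aff_inj (C : numClosedFieldType) (c p q : C) :
  p * p^* - q * q^* != 0 -> injective (aff c p q).
Proof.
rewrite /aff => h x y e; apply: (mulfI h).
have e' := congr1 Num.conj e.
move: e'; rewrite !(rmorphD, rmorphM) /= !conjCK => e'.
apply: (eq_of_diff (eq_sum (eq_scale p^* e) (eq_scale (-q) e'))); ring.
Qed.

(** Gives the line through two points of the circle a single equation in [z] and [z^*]. It expresses
    that [(z - x) / (y - x)] is its own conjugate, with [x^* = x^-1] and [y^* = y^-1]. *)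
Lemma unit_chordP (C : numClosedFieldType) (x y z : C) :
  `|x| = 1 -> `|y| = 1 -> x != y ->
  (exists2 t, t \is Num.real & z = x + t * (y - x)) <->
  z + x * y * z^* = x + y.
Proof.
move=> hx hy nxy; have x0 := unit_neq0 hx; have y0 := unit_neq0 hy.
have nz : y - x != 0 by rewrite subr_eq0 eq_sym.
split=> [[t /CrealP ht ->]|h].
  rewrite rmorphD rmorphM rmorphB /= ht !conj_unit //.
  by field; rewrite x0 y0.
exists ((z - x) / (y - x)); last by rewrite divfK // addrC subrK.
apply/CrealP; have hz : z^* = (x + y - z) / (x * y).
  by rewrite -h; field; rewrite x0 y0.
rewrite rmorphM fmorphV !rmorphB /= hz !conj_unit //; field.
by rewrite x0 y0 nz mulN1r subr_eq0 nxy.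
Qed.

Lemma unit_chord_unit (C : numClosedFieldType) (x y z : C) :
  `|z| = 1 -> z + x * y * z^* = x + y -> z = x \/ z = y.
Proof.
move=> hz; rewrite conj_unit // => h; have z0 := unit_neq0 hz.
have : (z - x) * (z - y) = 0.
  by apply: (eq_of_diff (eq_scale z h)); field.
move/eqP; rewrite mulf_eq0 !subr_eq0.
by case/orP => /eqP ->; [left|right].
Qed.

(* The chord xy meets the curve at the unimodular roots of the self-reciprocal
   quadratic M u^2 + K u + N; these come in pairs, so there is exactly one
   iff the discriminant K^2 - 4 M N vanishes. *)
Lemma tangent_unit_chordP (C : numClosedFieldType) (d m n x y : C) :
  `|x| = 1 -> `|y| = 1 -> m * m^* - n * n^* != 0 ->
  (exists! u, `|u| = 1 /\ aff d m n u + x * y * (aff d m n u)^* = x + y) <->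
  chord_conic (2 * d) (2 * d)^* (d ^+ 2 - 4 * m * n)
    (d ^+ 2 - 4 * m * n)^* (2 * d * d^* - 4 * (m * m^* + n * n^*))
    (x + y) (x * y) = 0.
Proof.
move=> hx hy hmn; set s := x + y; set w := x * y.
have hw : `|w| = 1 by rewrite normrM hx hy mulr1.
have w0 := unit_neq0 hw; have wV := conj_unit hw.
have sE : s^* = s / w.
  rewrite rmorphD /= !conj_unit // /s /w; field.
  by rewrite !unit_neq0.
(* Multiplying the line equation at [aff d m n u] by [u] gives [M * u ^+ 2 + K * u + N = 0]. [KE]
   and [ME] express that this quadratic is self-reciprocal. *)
pose K := d + w * d^* - s; pose M := m + w * n^*; pose N := n + w * m^*.
have KE : K^* = K / w.
  by rewrite /K rmorphB rmorphD rmorphM /= conjCK wV sE; field.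
have ME : M^* = N / w by rewrite /M /N rmorphD rmorphM /= conjCK wV; field.
have M0 : M != 0.
  apply: contraNneq hmn => e.
  have N0 : N = 0 by apply/eqP; rewrite -[N](divfK w0) -ME e rmorph0 mul0r.
  have -> : m * m^* - n * n^* = m^* * M - n^* * N by rewrite /M /N; ring.
  by rewrite e N0 !mulr0 subrr.
have N0 : N != 0.
  by rewrite -[N](divfK w0) -ME mulf_neq0 // conjC_eq0.
have mem u : `|u| = 1 ->
    (aff d m n u + w * (aff d m n u)^* = s <-> M * u ^+ 2 + K * u + N = 0).
  move=> hu; rewrite /aff 2!rmorphD !rmorphM /= conjCK conj_unit //.
  have u0 := unit_neq0 hu; split=> h.
    by apply: (eq_of_diff (eq_scale u h)); rewrite /M /K /N; field.
  apply: (mulfI u0).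
  by apply: (eq_of_diff h); rewrite /M /K /N; field.
have -> : chord_conic (2 * d) (2 * d)^* (d ^+ 2 - 4 * m * n)
    (d ^+ 2 - 4 * m * n)^* (2 * d * d^* - 4 * (m * m^* + n * n^*)) s w
    = K ^+ 2 - 4 * M * N.
  rewrite /chord_conic /K /M /N rmorphB !rmorphM !rmorph_nat /=; ring.
split=> [[u [[hu /(mem u hu) eu] uniq]]|h].
  (* The other root [v] comes from the product of the roots, [N / M]. It is again unimodular, so
     uniqueness forces a double root. *)
  have u0 := unit_neq0 hu; pose v := N / (M * u).
  have hv : `|v| = 1.
    rewrite /v normf_div normrM hu mulr1 -(norm_conjC M) ME normf_div hw divr1.
    by rewrite divff // normr_eq0.
  have KE' : K = - (M * u + N / u).
    by apply: (mulfI u0); apply: (eq_of_diff eu); field.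
  have /uniq e : `|v| = 1 /\ aff d m n v + w * (aff d m n v)^* = s.
    split=> //; apply/(mem v hv); rewrite KE' /v; field.
    by rewrite M0 u0.
  have NE : N = M * u ^+ 2.
    by rewrite expr2 mulrA {2}e /v; field; rewrite M0 u0.
  by rewrite KE' NE; field.
(* The double root. Its squared modulus is [K ^+ 2 / (4 * M * N)], which is 1 when the discriminant
   vanishes. *)
pose u := - K / (2 * M).
have two0 : 2 != 0 :> C by rewrite pnatr_eq0.
have eu : M * u ^+ 2 + K * u + N = 0.
  apply: (mulfI M0); apply: (mulfI (mulf_neq0 two0 two0)).
  by apply: (eq_of_diff (eq_scale (-1) h)); rewrite /u; field.
have hu : `|u| = 1.
  apply/eqP; rewrite -sqrp_eq1 // normCK /u rmorphM fmorphV rmorphN rmorphM.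
  rewrite /= rmorph_nat KE ME; apply/eqP.
  have K2 : K ^+ 2 = 4 * M * N by apply/subr0_eq.
  transitivity (K ^+ 2 / (4 * M * N)); first by field; rewrite w0 M0 N0.
  by rewrite K2 divff // !mulf_neq0 // pnatr_eq0.
exists u; split; first by split=> //; apply/(mem u hu).
move=> v [hv /(mem v hv) ev].
have : (v - u) ^+ 2 = 0.
  apply: (mulfI M0); apply: (mulfI M0).
  apply: (eq_of_diff (eq_sum (eq_scale M ev) (eq_scale 4^-1 h))).
  by rewrite /u; field.
by move/eqP; rewrite sqrf_eq0 subr_eq0 => /eqP.
Qed.

(** * The pulled-back inner ellipse and its foci *)

Lemma aff_comp (C : numClosedFieldType) (c p q c' p' q' : C) :
  p * p^* - q * q^* != 0 -> p' * p'^* - q' * q'^* != 0 ->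
  exists d m n, m * m^* - n * n^* != 0 /\
    forall u, aff c' p' q' u = aff c p q (aff d m n u).
Proof.
move Dd : (p * p^* - q * q^*) => D D0 D0'.
have DE : D^* = D.
  by rewrite -Dd rmorphB !rmorphM /= !conjCK mulrC [q^* * q]mulrC.
exists ((p^* * (c' - c) - q * (c' - c)^*) / D),
  ((p^* * p' - q * q'^*) / D), ((p^* * q' - q * p'^*) / D).
split=> [|u].
  rewrite !rmorphM !rmorphB !rmorphM !fmorphV /= !conjCK DE.
  set X := (X in X != 0).
  suff -> : X = (p' * p'^* - q' * q'^*) / D by rewrite mulf_neq0 // invr_eq0.
  by rewrite /X -Dd; field; rewrite Dd.
rewrite /aff !(rmorphD, rmorphM, rmorphN, fmorphV) /= !conjCK DE -Dd.
by field; rewrite Dd.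
Qed.

(** The foci [d + k * w] and [d - k * w] are convex combinations of the antipodal curve points
    [d + w] and [d - w], the images of [u] and [- u], and the disk is convex. *)
Lemma foci_in_disk (C : numClosedFieldType) (d m n : C) :
  (forall u, `|u| = 1 -> `|aff d m n u| < 1) ->
  exists f g, [/\ `|f| < 1, `|g| < 1, f + g = 2 * d
    & f * g = d ^+ 2 - 4 * m * n].
Proof.
move=> hin.
(* The foci are d +- 2 sqrt(m n), and the direction of sqrt(m n) is that of the
   major axis. *)
suff [u [k [hu hk hkr]]] : exists u k : C, [/\ `|u| = 1, 0 <= k <= 1 &
    (k * (m * u + n * u^*)) ^+ 2 = 4 * m * n].
  set w := m * u + n * u^* in hkr *.
  have w1 : `|d + w| < 1 by have := hin _ hu; rewrite /aff -addrA.
  have w2 : `|d - w| < 1.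
    have := hin (- u); rewrite normrN => /(_ hu).
    by rewrite /aff rmorphN /= !mulrN -addrA -opprD.
  have [k0 k1] := andP hk.
  have conv (a b : C) : `|a| < 1 -> `|b| < 1 ->
      `|(1 + k) / 2 * a + (1 - k) / 2 * b| < 1.
    move=> ha hb; apply: le_lt_trans (ler_normD _ _) _.
    rewrite [`|_ * a|]normrM [`|_ * b|]normrM.
    have c1 : 0 < (1 + k) / 2 by rewrite divr_gt0 // ltr_pwDl.
    have c2 : 0 <= (1 - k) / 2 by rewrite divr_ge0 // subr_ge0.
    rewrite (gtr0_norm c1) (ger0_norm c2).
    have e1 : 1 = (1 + k) / 2 * 1 + (1 - k) / 2 * 1 :> C by field.
    rewrite [ltRHS]e1.
    by apply: ltr_leD; [rewrite ltr_pM2l | apply: ler_wpM2l => //; apply: ltW].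
  exists (d + k * w), (d - k * w); split.
  - have -> : d + k * w = (1 + k) / 2 * (d + w) + (1 - k) / 2 * (d - w).
      by field.
    exact: conv.
  - have -> : d - k * w = (1 + k) / 2 * (d - w) + (1 - k) / 2 * (d + w).
      by field.
    exact: conv.
  - by ring.
  - by rewrite -hkr; ring.
(* If [m] or [n] vanishes, both foci are [d] and [k = 0] works. *)
have [->|m0] := eqVneq m 0.
  by exists 1, 0; rewrite normr1 lexx ler01; split=> //; ring.
have [->|n0] := eqVneq n 0.
  by exists 1, 0; rewrite normr1 lexx ler01; split=> //; ring.
pose r := sqrtC (m * n).
have r2 : r ^+ 2 = m * n by rewrite sqrtCK.
have r0 : r != 0 by rewrite sqrtC_eq0 mulf_neq0.
have am0 : `|m| != 0 by rewrite normr_eq0.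
have ar0 : `|r| != 0 by rewrite normr_eq0.
have an0 : `|n| != 0 by rewrite normr_eq0.
have amn : `|m| * `|n| = `|r| ^+ 2 by rewrite -normrM -r2 normrX.
have mm := normCK m. have rr := normCK r.
have mb0 : m^* != 0 by rewrite conjC_eq0.
have rb0 : r^* != 0 by rewrite conjC_eq0.
have smn : 0 < `|m| + `|n| by apply: addr_gt0; rewrite normr_gt0.
(* This [u] gives [m * u] and [n * u^*] the common direction of [r], so [w] is a semi-major axis of
   length [|m| + |n|]. The factor [k] is the eccentricity, at most 1 by the inequality of means. *)
exists (r * `|m| / (`|r| * m)), (2 * `|r| / (`|m| + `|n|)).
have real_conj (x : C) : (`|x|)^* = `|x| by apply/CrealP; apply: normr_real.
have wE : m * (r * `|m| / (`|r| * m)) + n * (r * `|m| / (`|r| * m))^* =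
    r / `|r| * (`|m| + `|n|).
  rewrite !(rmorphM, fmorphV) /= !real_conj.
  have -> : `|n| = `|r| ^+ 2 / `|m| by rewrite -amn mulrC mulrA mulVf ?mul1r.
  have -> : n = r ^+ 2 / m by rewrite r2 mulrC mulrA mulVf ?mul1r.
  have -> : m^* = `|m| ^+ 2 / m by rewrite mm mulrC mulrA mulVf ?mul1r.
  have -> : r^* = `|r| ^+ 2 / r by rewrite rr mulrC mulrA mulVf ?mul1r.
  by field; rewrite m0 r0 am0 ar0.
split.
- by rewrite normf_div !normrM !normr_id divff // mulf_neq0.
- rewrite divr_ge0 ?addr_ge0 ?mulr_ge0 //= ler_pdivrMr // mul1r.
  rewrite -(ler_pXn2r (n := 2)) ?nnegrE ?mulr_ge0 ?addr_ge0 //.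
  rewrite exprMn -amn -subr_ge0.
  have -> : (`|m| + `|n|) ^+ 2 - 2 ^+ 2 * (`|m| * `|n|) = (`|m| - `|n|) ^+ 2.
    by ring.
  by rewrite real_exprn_even_ge0 // rpredB // normr_real.
- rewrite wE -[RHS]mulrA -r2; field.
  by rewrite ar0 lt0r_neq0.
Qed.

(** * Circumcenters of triangles inscribed in an affine image of the unit circle *)

(** Expanding the squared distances with [x^* = x^-1] and [y^* = y^-1] leaves a difference divisible
    by [x - y]. That [p * q^*] is real holds for an ellipse, where [p] and [q] are real multiples of
    the axis ([half_real]). *)
Lemma circumcenter_pair (C : numClosedFieldType) (c p q o x y : C) :
  `|x| = 1 -> `|y| = 1 -> x != y -> (p * q^*)^* = p * q^* ->
  (`|c + o - aff c p q x| = `|c + o - aff c p q y| <->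
   p * o^* + q^* * o - (p * o^* + q^* * o)^* / (x * y)
     = p * q^* * (x + y) * (1 - (x * y) ^- 2)).
Proof.
move=> hx hy nxy hA; have x0 := unit_neq0 hx; have y0 := unit_neq0 hy.
have nz : x - y != 0 by rewrite subr_eq0.
have sq : `|c + o - aff c p q x| = `|c + o - aff c p q y| <->
    `|c + o - aff c p q x| ^+ 2 = `|c + o - aff c p q y| ^+ 2.
  split=> [-> //|/eqP]; rewrite eqrXn2 //; exact: eqP.
apply: (iff_trans sq); rewrite !normCK /aff.
rewrite !(rmorphD, rmorphB, rmorphM, rmorphN) /= !conjCK.
rewrite (conj_unit hx) (conj_unit hy).
have hA' : p^* * q = p * q^* by move: hA; rewrite rmorphM /= conjCK.
split=> h.
  apply: (mulfI nz); apply: (eq_of_diff (eq_sum (eq_scale (-1) h)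
    (eq_scale (x ^- 2 - y ^- 2) hA'))).
  by field; rewrite x0 y0.
apply: (eq_of_diff (eq_sum (eq_scale (y - x) h)
    (eq_scale (x ^- 2 - y ^- 2) hA'))).
by field; rewrite x0 y0.
Qed.

Lemma circumcenter_aff (C : numClosedFieldType) (c p q o x y z : C) :
  `|x| = 1 -> `|y| = 1 -> `|z| = 1 -> x != y -> y != z -> z != x ->
  (p * q^*)^* = p * q^* -> p * p^* - q * q^* != 0 ->
  (`|c + o - aff c p q x| = `|c + o - aff c p q y| /\
   `|c + o - aff c p q y| = `|c + o - aff c p q z|) <->
  o = p * q^* / (p * p^* - q * q^*) *
    (p * ((x + y + z)^* + x * y * z) - q * (x + y + z + (x * y * z)^*)).
Proof.
move=> hx hy hz nxy nyz nzx hA D0.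
have x0 := unit_neq0 hx; have y0 := unit_neq0 hy; have z0 := unit_neq0 hz.
have nz : z - x != 0 by rewrite subr_eq0.
have hxy := circumcenter_pair c o hx hy nxy hA.
have hyz := circumcenter_pair c o hy hz nyz hA.
set A := p * q^* in hA hxy hyz *.
move Ud : (p * o^* + q^* * o) hxy hyz => U hxy hyz.
have UE : U^* = p^* * o + q * o^*.
  by rewrite -Ud rmorphD !rmorphM /= !conjCK.
have oE : o * (p * p^* - q * q^*) = p * U^* - q * U by rewrite UE -Ud; ring.
split=> [[/hxy e1 /hyz e2]|h].
  have V : U^* = A * ((x + y + z)^* + x * y * z).
    rewrite !rmorphD /= (conj_unit hx) (conj_unit hy) (conj_unit hz).
    apply: (mulfI nz).
    apply: (eq_of_diff (eq_sum (eq_scale (- (x * y * z)) e1)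
      (eq_scale (x * y * z) e2))).
    by field; rewrite x0 y0 z0.
  have W : U = A * (x + y + z + (x * y * z)^*).
    by rewrite -[U]conjCK V rmorphM rmorphD /= hA conjCK.
  by apply: (mulIf D0); rewrite oE V W; field.
have oE' : o * (p * p^* - q * q^*) =
    A * (p * ((x + y + z)^* + x * y * z) - q * (x + y + z + (x * y * z)^*)).
  by rewrite h; field.
have W : U = A * (x + y + z + (x * y * z)^*).
  have DE : (p * p^* - q * q^*)^* = p * p^* - q * q^*.
    by rewrite rmorphB !rmorphM /= !conjCK mulrC [q^* * q]mulrC.
  have := congr1 Num.conj oE'.
  rewrite rmorphM /= DE rmorphM /= hA rmorphB /= !rmorphM /=.
  rewrite !rmorphD !rmorphM /= !conjCK => oE''.
  move: oE'; rewrite !rmorphD !rmorphM /= => oE'.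
  apply: (mulIf D0).
  apply: (eq_of_diff (eq_sum (eq_scale q^* oE') (eq_scale p oE''))).
  rewrite -Ud; ring.
have V : U^* = A * ((x + y + z)^* + x * y * z).
  by rewrite W rmorphM rmorphD /= hA conjCK.
split; [apply/hxy|apply/hyz]; rewrite V W !(rmorphD, rmorphM) /= (conj_unit hx)
    (conj_unit hy) (conj_unit hz).
  by field; rewrite x0 y0 z0.
by field; rewrite x0 y0 z0.
Qed.

(** * Ellipses of the plane as affine images of the unit circle *)

Lemma conj_complex (R : realType) (x y : R) :
  Num.conj (x +i* y) = x +i* (- y).
Proof. by []. Qed.

Lemma sqr_norm_complex (R : realType) (x y : R) :
  `|x +i* y| ^+ 2 = (x ^+ 2 + y ^+ 2)%:C.
Proof. by rewrite -add_Re2_Im2. Qed.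

Lemma norm_complex_eq1 (R : realType) (x y : R) :
  (`|x +i* y| == 1) = (x ^+ 2 + y ^+ 2 == 1).
Proof.
by rewrite -sqrp_eq1 // sqr_norm_complex -(inj_eq (@complexI R)).
Qed.

Lemma norm_complex_lt1 (R : realType) (x y : R) :
  (`|x +i* y| < 1) = (x ^+ 2 + y ^+ 2 < 1).
Proof.
by rewrite -(expr_lt1 (n := 2)) // sqr_norm_complex -ltcR.
Qed.

(** For [z = x +i* y], the point with coordinates [a * x] and [b * y] is
    [(a + b) / 2 * z + (a - b) / 2 * z^*]; this is the coefficient of [z], and [half_diff] that of
    [z^*]. *)
Definition half_sum (R : realType) (E : ellipse R) : R[i] :=
  axis E * ((semiaxis1 E + semiaxis2 E) / 2)%:C.

Definition half_diff (R : realType) (E : ellipse R) : R[i] :=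
  axis E * ((semiaxis1 E - semiaxis2 E) / 2)%:C.

Definition ellipse_param (R : realType) (E : ellipse R) : R[i] -> R[i] :=
  aff (center E) (half_sum E) (half_diff E).

Lemma ellipse_paramE (R : realType) (E : ellipse R) (x y : R) :
  ellipse_param E (x +i* y) =
  center E + axis E * ((semiaxis1 E * x) +i* (semiaxis2 E * y)).
Proof.
rewrite /ellipse_param /aff /half_sum /half_diff conj_complex.
rewrite -!mulrA -addrA -mulrDr; congr (_ + _ * _).
by simpc; congr (_ +i* _); field.
Qed.

Lemma curveP (R : realType) (E : ellipse R) (w : R[i]) :
  curve E w <-> exists2 u, `|u| = 1 & w = ellipse_param E u.
Proof.
split=> [[x [y [xy ->]]]|[[x y] /eqP]].
  exists (x +i* y); last by rewrite ellipse_paramE.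
  by apply/eqP; rewrite norm_complex_eq1 xy.
by rewrite norm_complex_eq1 ellipse_paramE => /eqP xy ->; exists x, y.
Qed.

Lemma inner_regionP (R : realType) (E : ellipse R) (w : R[i]) :
  inner_region E w <-> exists2 u, `|u| < 1 & w = ellipse_param E u.
Proof.
split=> [[x [y [xy ->]]]|[[x y]]].
  by exists (x +i* y); [rewrite norm_complex_lt1|rewrite ellipse_paramE].
by rewrite norm_complex_lt1 ellipse_paramE => xy ->; exists x, y.
Qed.

Lemma lineP (R : realType) (A B z : R[i]) :
  line A B z <-> exists2 t, t \is Num.real & z = A + t * (B - A).
Proof.
split=> [[t ->]|[t /complex_realP [k ->] ->]]; last by exists k.
by exists t%:C => //; rewrite complex_real.
Qed.


Lemma conj_real (R : realType) (k : R) : (k%:C)^* = k%:C.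
Proof. by rewrite conj_complex oppr0. Qed.

Lemma half_real (R : realType) (E : ellipse R) :
  (half_sum E * (half_diff E)^*)^* = half_sum E * (half_diff E)^*.
Proof.
rewrite /half_sum /half_diff !rmorphM /= !conj_real conjCK; ring.
Qed.

Lemma half_jacobian (R : realType) (E : ellipse R) :
  half_sum E * (half_sum E)^* - half_diff E * (half_diff E)^*
  = (semiaxis1 E * semiaxis2 E)%:C.
Proof.
have h := mul_conj_unit (axis_unit E).
rewrite /half_sum /half_diff !(rmorphM Num.conj) /= !conj_real.
have -> : semiaxis1 E * semiaxis2 E =
    ((semiaxis1 E + semiaxis2 E) / 2) ^+ 2 -
    ((semiaxis1 E - semiaxis2 E) / 2) ^+ 2 by field.
rewrite rmorphB !rmorphXn /=.
set a := ((semiaxis1 E + _) / 2)%:C; set b := ((semiaxis1 E - _) / 2)%:C.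
by apply: (eq_of_diff (eq_scale (a ^+ 2 - b ^+ 2) h)); ring.
Qed.

Lemma half_jacobian_neq0 (R : realType) (E : ellipse R) :
  nondegenerate_ellipse E ->
  half_sum E * (half_sum E)^* - half_diff E * (half_diff E)^* != 0.
Proof.
move=> [a0 b0]; rewrite half_jacobian; apply/eqP => -[] /eqP.
by rewrite mulf_eq0 !gt_eqF.
Qed.

Lemma ellipse_param_inj (R : realType) (E : ellipse R) :
  nondegenerate_ellipse E -> injective (ellipse_param E).
Proof. by move=> hE; apply: aff_inj; apply: half_jacobian_neq0. Qed.

Lemma line_paramP (R : realType) (E : ellipse R) (x y z : R[i]) :
  nondegenerate_ellipse E -> `|x| = 1 -> `|y| = 1 -> x != y ->
  line (ellipse_param E x) (ellipse_param E y) (ellipse_param E z) <->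
  z + x * y * z^* = x + y.
Proof.
move=> hE hx hy nxy; rewrite lineP -unit_chordP //.
split=> -[t ht e]; exists t => //; last by rewrite e; apply: aff_chord.
by apply: (ellipse_param_inj hE); rewrite e; apply/esym/aff_chord.
Qed.

(** The affine map preserves lines, and a chord line meets the circle only at its endpoints, so
    three distinct points are never collinear. *)
Lemma triangle_paramP (R : realType) (E : ellipse R) (x y z : R[i]) :
  nondegenerate_ellipse E -> `|x| = 1 -> `|y| = 1 -> `|z| = 1 ->
  triangle (ellipse_param E x) (ellipse_param E y) (ellipse_param E z) <->
  [/\ x != y, y != z & z != x].
Proof.
move=> hE hx hy hz; split=> [[nAB nl]|[nxy nyz nzx]].
  have nxy : x != y by apply/eqP => e; apply: nAB; rewrite e.
  move: nl => /(line_paramP z hE hx hy nxy) nl; split=> //.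
    apply/eqP => e; apply: nl; rewrite -e -mulrA mul_conj_unit // mulr1.
    exact: addrC.
  by apply/eqP => e; apply: nl; rewrite e mulrAC mul_conj_unit // mul1r.
split; first by move/(ellipse_param_inj hE)/eqP; rewrite (negPf nxy).
move=> /(line_paramP z hE hx hy nxy) /(unit_chord_unit hz).
by case=> /eqP; [|rewrite eq_sym]; apply/negP.
Qed.

(** Having exactly one common point is invariant under the injective affine map [ellipse_param E],
    so tangency can be tested on the unit circle. *)
Lemma tangent_paramP (R : realType) (E E' : ellipse R) (d m n x y : R[i]) :
  nondegenerate_ellipse E -> nondegenerate_ellipse E' ->
  m * m^* - n * n^* != 0 ->
  (forall u, ellipse_param E' u = ellipse_param E (aff d m n u)) ->
  `|x| = 1 -> `|y| = 1 -> x != y ->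
  tangent (line (ellipse_param E x) (ellipse_param E y)) E' <->
  chord_conic (2 * d) (2 * d)^* (d ^+ 2 - 4 * m * n)
    (d ^+ 2 - 4 * m * n)^* (2 * d * d^* - 4 * (m * m^* + n * n^*))
    (x + y) (x * y) = 0.
Proof.
move=> hE hE' hmn hp hx hy nxy; rewrite -tangent_unit_chordP //.
split=> [[p [[lp /curveP [u hu pu]] uniq]]|[u [[hu lu] uniq]]].
  exists u; split=> [|v [hv lv]].
    by split=> //; apply/(line_paramP _ hE hx hy nxy); rewrite -hp -pu.
  apply: (ellipse_param_inj hE'); rewrite -pu; apply: uniq; split.
    by rewrite hp; apply/(line_paramP _ hE hx hy nxy).
  by apply/curveP; exists v.
exists (ellipse_param E' u); split=> [|p [lp /curveP [v hv pv]]].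
  split; last by apply/curveP; exists u.
  by rewrite hp; apply/(line_paramP _ hE hx hy nxy).
rewrite pv; congr ellipse_param; apply: uniq; split=> //.
by apply/(line_paramP _ hE hx hy nxy); rewrite -hp -pv.
Qed.

(** * Curves of the form [w + u * l + v * l^*] with [l] unimodular *)

(** The value 1 at 0 keeps the phase unimodular everywhere. *)
Definition phase (C : numClosedFieldType) (z : C) : C :=
  if z == 0 then 1 else z / `|z|.

Lemma norm_phase (C : numClosedFieldType) (z : C) : `|phase z| = 1.
Proof.
rewrite /phase; case: eqVneq => [_|z0]; first by rewrite normr1.
by rewrite normf_div normr_id divff // normr_eq0.
Qed.

Lemma phaseE (C : numClosedFieldType) (z : C) : z = `|z| * phase z.
Proof.
rewrite /phase; case: eqVneq => [->|z0]; first by rewrite normr0 mul0r.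
by rewrite mulrC divfK // normr_eq0.
Qed.

(** Rotating the parameter gives both terms the same direction [e], a square root of the product of
    the phases of [u] and [v]. The semi-axes are then the sum and the difference of the two
    moduli. *)
Lemma curve_trig (R : realType) (w u v : R[i]) :
  exists L : ellipse R,
    curve L = [set Z | exists2 l, `|l| = 1 & Z = w + u * l + v * l^*]%classic.
Proof.
have le_case (u' v' : R[i]) : `|v'| <= `|u'| -> exists L : ellipse R,
    curve L = [set Z | exists2 l, `|l| = 1 & Z = w + u' * l + v' * l^*]%classic.
  move=> le; pose a := complex.Re `|u'|; pose b := complex.Re `|v'|.
  have aE : a%:C = `|u'| by exact: (RRe_real (normr_real _)).
  have bE : b%:C = `|v'| by exact: (RRe_real (normr_real _)).
  have ab : 0 <= a - b by rewrite subr_ge0 -lecR aE bE.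
  have apb : 0 <= a + b by apply: addr_ge0; rewrite -lecR ?aE ?bE normr_ge0.
  pose e := sqrtC (phase u' * phase v').
  have e2 : e ^+ 2 = phase u' * phase v' by rewrite sqrtCK.
  have he : `|e| = 1.
    by apply/eqP; rewrite -sqrp_eq1 // -normrX e2 normrM !norm_phase mulr1.
  pose k := phase u' / e.
  have hk : `|k| = 1 by rewrite normf_div norm_phase he divr1.
  have e0 := unit_neq0 he; have k0 := unit_neq0 hk.
  exists (Ellipse w he apb ab).
  have param l : ellipse_param (Ellipse w he apb ab) (k * l)
      = w + u' * l + v' * l^*.
    rewrite /ellipse_param /aff /half_sum /half_diff /=.
    have -> : (a + b + (a - b)) / 2 = a by field.
    have -> : (a + b - (a - b)) / 2 = b by field.
    rewrite aE bE {2}(phaseE u') {2}(phaseE v') rmorphM /= (conj_unit hk).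
    have pu0 : phase u' != 0 by rewrite unit_neq0 ?norm_phase.
    have -> : phase v' = e ^+ 2 / phase u' by rewrite e2 mulrC mulKf.
    by rewrite /k; field; rewrite e0 pu0.
  apply/seteqP; split=> Z /=.
    move=> /curveP [l hl ->].
    exists (l / k); first by rewrite normf_div hl hk divr1.
    by rewrite -param mulrC divfK.
  move=> [l hl ->]; apply/curveP; exists (k * l); last by rewrite param.
  by rewrite normrM hk hl mulr1.
have [le|le] := real_leP (normr_real v) (normr_real u); first exact: le_case.
have [L hL] := le_case v u (ltW le).
(* Replacing [l] by [l^*] exchanges [u] and [v]. *)
exists L; rewrite hL; apply/seteqP; split=> Z /= [l hl ->]; exists l^*;
  by rewrite ?norm_conjC ?conjCK // addrAC.
Qed.

(** * Poncelet triangles and the locus *)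

Lemma poncelet_paramP (R : realType) (E E' : ellipse R) (d m n x y z : R[i]) :
  nondegenerate_ellipse E -> nondegenerate_ellipse E' ->
  m * m^* - n * n^* != 0 ->
  (forall u, ellipse_param E' u = ellipse_param E (aff d m n u)) ->
  `|x| = 1 -> `|y| = 1 -> `|z| = 1 ->
  let F := 2 * d in let H := d ^+ 2 - 4 * m * n in
  poncelet E E' (ellipse_param E x) (ellipse_param E y) (ellipse_param E z) <->
  [/\ x != y, y != z & z != x] /\
  [/\ x + y + z = F + x * y * z * H^*,
      x * y + y * z + z * x = H + x * y * z * F^* &
      2 * d * d^* - 4 * (m * m^* + n * n^*) = F * F^* - H * H^* - 1].
Proof.
move=> hE hE' hmn hp hx hy hz F H.
split=> [[/(triangle_paramP hE hx hy hz) [nxy nyz nzx] _ [txy tyz tzx]]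
        |[[nxy nyz nzx] [h1 h2 hB]]].
  split=> //; apply: (chord_conic_triangle (unit_neq0 hx) nxy nyz nzx).
  - exact/(tangent_paramP hE hE' hmn hp hx hy nxy).
  - exact/(tangent_paramP hE hE' hmn hp hy hz nyz).
  - exact/(tangent_paramP hE hE' hmn hp hz hx nzx).
split.
- by apply/triangle_paramP.
- by split; apply/curveP; [exists x|exists y|exists z].
split.
- apply/(tangent_paramP hE hE' hmn hp hx hy nxy).
  exact: chord_conicP h1 h2 hB.
- apply/(tangent_paramP hE hE' hmn hp hy hz nyz).
  have e : y * z * x = x * y * z by ring.
  by apply: (@chord_conicP _ _ _ _ _ _ y z x) hB;
    rewrite e -?h1 -?h2; ring.
- apply/(tangent_paramP hE hE' hmn hp hz hx nzx).
  have e : z * x * y = x * y * z by ring.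
  by apply: (@chord_conicP _ _ _ _ _ _ z x y) hB;
    rewrite e -?h1 -?h2; ring.
Qed.

Theorem corollary1 (R : realType) (E E' : ellipse R)
  (hE : nondegenerate_ellipse E) (hE' : nondegenerate_ellipse E')
  (hnested : nested E E')
  (hponcelet : exists A B C : R[i], poncelet E E' A B C)
  (Xk : R[i] -> R[i] -> R[i] -> R[i])
  (hcenter : triangle_center Xk)
  (hstationary : stationary E E' Xk)
  (alpha beta gamma : R[i]) :
  exists L : ellipse R, locus E E' alpha beta gamma Xk = curve L.
Proof.
have [d [m [n [hmn hp]]]] := aff_comp (center E) (center E')
  (half_jacobian_neq0 hE) (half_jacobian_neq0 hE').
have in_disk u : `|u| = 1 -> `|aff d m n u| < 1.
  move=> hu.
  have /hnested/inner_regionP [v hv e] : curve E' (ellipse_param E' u).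
    by apply/curveP; exists u.
  by rewrite (ellipse_param_inj hE (etrans (esym (hp u)) e)).
have [f [g [hf hg hF hH]]] := foci_in_disk in_disk.
have ponP x y z hx hy hz :=
  @poncelet_paramP R E E' d m n x y z hE hE' hmn hp hx hy hz.
set F := 2 * d in hF ponP; set H := d ^+ 2 - 4 * m * n in hH ponP.
have poncelet_param A B C : poncelet E E' A B C -> exists x y z,
    [/\ `|x| = 1, `|y| = 1 & `|z| = 1] /\ [/\ A = ellipse_param E x,
        B = ellipse_param E y & C = ellipse_param E z].
  move=> [_ [/curveP [x hx ->] /curveP [y hy ->] /curveP [z hz ->]] _].
  by exists x, y, z.
(* The closure condition does not involve the vertices, so the one given triangle establishes it for
   the whole family. *)
have hB : 2 * d * d^* - 4 * (m * m^* + n * n^*) = F * F^* - H * H^* - 1.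
  have [A [B [C hABC]]] := hponcelet.
  have [x [y [z [[hx hy hz] [eA eB eC]]]]] := poncelet_param _ _ _ hABC.
  by move: hABC; rewrite eA eB eC => /(ponP _ _ _ hx hy hz) [_ []].
have [P hP] := hstationary.
set c := center E; set p := half_sum E; set q := half_diff E.
set k := p * q^* / (p * p^* - q * q^*).
have D0 := half_jacobian_neq0 hE; rewrite -/p -/q in D0.
(* Constant term and coefficients of [l] and [l^*] after substituting [s1 = F + l * H^*] and its
   conjugate into both centers. *)
pose w := alpha * (c + (p * F + q * F^*) / 3)
     + beta * (c + k * (p * F^* - q * F)) + gamma * P.
pose u := alpha * (p * H^* / 3) + beta * (k * (p - q * H^*)).
pose v := alpha * (q * H / 3) + beta * (k * (p * H - q)).
have locusE x y z : x + y + z = F + x * y * z * H^* ->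
    alpha * barycenter (ellipse_param E x) (ellipse_param E y)
                       (ellipse_param E z)
    + beta * (c + k * (p * ((x + y + z)^* + x * y * z)
                       - q * (x + y + z + (x * y * z)^*)))
    + gamma * P = w + u * (x * y * z) + v * (x * y * z)^*.
  move=> h1; have s1 : x^* + y^* + z^* = F^* + (x * y * z)^* * H.
    by rewrite -!rmorphD h1 rmorphD rmorphM /= conjCK.
  have -> : barycenter (ellipse_param E x) (ellipse_param E y)
      (ellipse_param E z) =
      c + (p * (x + y + z) + q * (x^* + y^* + z^*)) / 3.
    by rewrite /barycenter /ellipse_param /aff -/c -/p -/q; field.
  rewrite !rmorphD /= s1 h1 /w /u /v; set l := x * y * z; ring.
have [L hL] := curve_trig w u v.
exists L; rewrite hL; apply/seteqP; split=> Z /=.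
  move=> [A [B [C [O [hABC hO ->]]]]]; rewrite (hP _ _ _ hABC).
  have [x [y [z [[hx hy hz] [eA eB eC]]]]] := poncelet_param _ _ _ hABC.
  move: hABC hO; rewrite eA eB eC => /(ponP _ _ _ hx hy hz).
  move=> [[nxy nyz nzx] [h1 _ _]] hO.
  exists (x * y * z); first by rewrite !normrM hx hy hz !mulr1.
  have cO : c + (O - c) = O by rewrite addrC subrK.
  rewrite -(locusE _ _ _ h1) -cO; congr (_ + _ * (_ + _) + _).
  apply/(circumcenter_aff c (O - c) hx hy hz nxy nyz nzx (half_real E) D0).
  by rewrite cO.
(* Every unimodular [l] is attained: its Blaschke fiber, together with [hB], yields a Poncelet
   triangle. *)
move=> [l hl ->]; have [x [y [z [[hx hy hz] [nxy nyz nzx] [h1 h2 h3]]]]] :=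
  blaschke_fiber hf hg hl.
rewrite hF hH -h3 in h1 h2.
have hABC := (ponP _ _ _ hx hy hz).2 (conj (And3 nxy nyz nzx) (And3 h1 h2 hB)).
set o := k * (p * ((x + y + z)^* + x * y * z)
              - q * (x + y + z + (x * y * z)^*)).
exists (ellipse_param E x), (ellipse_param E y), (ellipse_param E z), (c + o).
split=> //; last by rewrite (hP _ _ _ hABC) -h3 (locusE _ _ _ h1).
exact/(circumcenter_aff c o hx hy hz nxy nyz nzx (half_real E) D0).
Qed.
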